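(* Let $g$ be a Bernstein function that is a bijection of $(0,+\infty)$ onto itself, and let $A$ be a non-negative symmetric operator on $L^2(\mu)$. Let $\Psi=g^{-1}$ (a non-decreasing convex function from $(0,+\infty)$ to $(0,+\infty)$) and assume that $\Psi^*(x):=\sup_{y\in(0,+\infty)}(xy-\Psi(y))$ is a bijection from $(0,+\infty)$ to $(0,+\infty)$. Assume that $g(A)$ satisfies a super-Poincaré inequality with some rate function $\gamma:(0,+\infty)\to(0,+\infty)$, i.e. for every $f\in\mathcal D(g(A))\cap L^1(\mu)$, $$\|f\|_2^2\le r\,(g(A)f,f)+\gamma(r)\,\|f\|_1^2\qquad\text{for all } r>0.$$ Then $A$ satisfies a super-Poincaré inequality with rate function $$\gamma_\Psi(t)=\inf_{0<\varepsilon<1}\ \frac1\varepsilon\,\gamma\left(\varepsilon t\,(\Psi^* )^{-1}\left(\frac{1-\varepsilon}{\varepsilon t}\right)\right),\qquad t>0,$$ i.e. for every $f\in\mathcal D(A)\cap L^1(\mu)$ and every $t>0$, $\|f\|_2^2\le t\,(Af,f)+\gamma_\Psi(t)\,\|f\|_1^2$.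
   Context: $(X,\mu)$ is a $\sigma$-finite measure space, $(\cdot,\cdot)$ is the inner product of $L^2(\mu)$ and $\|\cdot\|_p$ the $L^p(\mu)$-norm. A Bernstein function is a $C^\infty$ function $g:(0,+\infty)\to(0,+\infty)$ with $(-1)^{n-1}g^{(n)}(s)\ge0$ for all integers $n\ge1$ and $s>0$; $g(0):=g(0^+)$. A non-negative, densely defined symmetric operator is not distinguished from its self-adjoint Friedrichs extension, so $A$ is regarded as a non-negative self-adjoint operator with spectral resolution $(E_\lambda)$; $g(A)=\int_0^{+\infty}g(\lambda)\,dE_\lambda$ on the domain $\mathcal D(g(A))=\{f\in L^2:\int_0^{+\infty}|g(\lambda)|^2d(E_\lambda f,f)<\infty\}$. *)

(* Defs.v *)
From HB Require Import structures.
From mathcomp Require Import all_boot all_order all_algebra.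
From mathcomp Require Import all_classical all_reals all_analysis.

Set Implicit Arguments.
Unset Strict Implicit.
Unset Printing Implicit Defensive.
Import Order.TTheory GRing.Theory Num.Theory.
Import numFieldNormedType.Exports.

Local Open Scope classical_set_scope.
Local Open Scope ring_scope.

(* The real space L^2(mu), represented by square-integrable functions; two
   functions represent the same vector when they agree almost everywhere, and
   all the notions below are compatible with this identification. *)
Notation L2 mu := (LfunType mu (lee1n 2)).

Section L2.
Context {d : measure_display} {T : measurableType d} {R : realType}.
Variable mu : {measure set T -> \bar R}.
Implicit Types f g h u v : L2 mu.

Definition Lpnorm (p : \bar R) (f : T -> R) : R :=
  fine ('N[mu]_p[EFin \o f])%E.

Definition inner f g : R := (\int[mu]_x (f x * g x))%R.

Lemma inner_integrable f g : mu.-integrable setT (EFin \o (f \* g)).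
Proof. by apply/Lfun1_integrable/Lfun2_mul_Lfun1; exact: LfunP. Qed.

Lemma innerC f g : inner f g = inner g f.
Proof. by apply: eq_Rintegral => x _; rewrite mulrC. Qed.

Lemma innerDl f g h : inner (f + g) h = inner f h + inner g h.
Proof.
rewrite /inner -RintegralD//; [|exact: inner_integrable..].
by apply: eq_Rintegral => x _ /=; rewrite mulrDl.
Qed.

Lemma innerZl a f h : inner (a *: f) h = a * inner f h.
Proof.
rewrite /inner -RintegralZl//; last exact: inner_integrable.
by apply: eq_Rintegral => x _ /=; rewrite mulrA.
Qed.

Lemma innerBl f g h : inner (f - g) h = inner f h - inner g h.
Proof. by rewrite innerDl -scaleN1r innerZl mulN1r. Qed.

Lemma innerff f : inner f f = Lpnorm 2%:E f ^+ 2.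
Proof.
rewrite -powR_mulrn; last exact/fine_ge0/Lnorm_ge0.
rewrite -fine_poweR poweR_Lnorm//; congr fine.
apply: eq_integral => x _ /=.
by rewrite powR_mulrn// real_normK ?num_real// expr2.
Qed.

Lemma inner_ae f f' h : f = f' %[ae mu] -> inner f h = inner f' h.
Proof.
move=> ff'; congr fine; apply: ae_eq_integral => //.
- exact: measurable_int (inner_integrable f h).
- exact: measurable_int (inner_integrable f' h).
- by apply: filterS ff' => x /(_ I) /= -> _.
Qed.

Record operator := Operator {
  dom : set (L2 mu) ;
  act :> L2 mu -> L2 mu ;
  dom0 : dom 0 ;
  dom_linear : forall a f g, dom f -> dom g -> dom (a *: f + g) ;
  dom_ae : forall f g, f = g %[ae mu] -> dom f -> dom g ;
  act_linear : forall a f g, dom f -> dom g ->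
    act (a *: f + g) = a *: act f + act g %[ae mu] ;
  act_ae : forall f g, f = g %[ae mu] -> dom f -> act f = act g %[ae mu] }.

Definition densely_defined (A : operator) :=
  forall f e, 0 < e -> exists2 u, dom A u & Lpnorm 2%:E (f - u) < e.

Definition symmetric_op (A : operator) :=
  forall u v, dom A u -> dom A v -> inner (A u) v = inner u (A v).

Definition nonnegative_op (A : operator) :=
  forall u, dom A u -> 0 <= inner (A u) u.

(* Graph of the Friedrichs extension of A: the operator associated with the
   closure q of the form (u, v) |-> (A u, v) on dom A.  A vector f is in the
   domain of q when it is the L^2-limit of a sequence u_n of dom A that is
   Cauchy for the form, and then q(f, v) = lim (A u_n, v) for v in dom A, which
   is a core of q; the extension maps f to h when q(f, v) = (h, v) for every v
   in that core. *)
Definition friedrichs (A : operator) (f h : L2 mu) : Prop :=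
  exists u : nat -> L2 mu,
  [/\ forall n, dom A (u n),
      Lpnorm 2%:E (u n - f) @[n --> \oo] --> (0 : R),
      forall e : R, 0 < e -> exists N, forall m n, (N <= m)%N -> (N <= n)%N ->
        inner (A (u m - u n)) (u m - u n) < e &
      forall v, dom A v -> inner (A (u n)) v @[n --> \oo] --> inner h v].

(* A spectral resolution (E_lambda) carried by [0, +oo[: a right-continuous
   increasing family of orthogonal projections. *)
Record spectral_resolution := SpectralResolution {
  proj :> R -> L2 mu -> L2 mu ;
  proj_ae : forall l f g, f = g %[ae mu] -> proj l f = proj l g %[ae mu] ;
  proj_linear : forall l a f g,
    proj l (a *: f + g) = a *: proj l f + proj l g %[ae mu] ;
  proj_sym : forall l f g, inner (proj l f) g = inner f (proj l g) ;
  proj_min : forall l m f,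
    proj l (proj m f) = proj (Num.min l m) f %[ae mu] ;
  proj_right_continuous : forall l f,
    Lpnorm 2%:E (proj m f - proj l f) @[m --> l^'+] --> (0 : R) ;
  proj_lt0 : forall l f, l < 0 -> proj l f = 0 %[ae mu] ;
  proj_cvg : forall f, Lpnorm 2%:E (proj l f - f) @[l --> +oo] --> (0 : R) }.

Section spectral_integral.
Variable E : spectral_resolution.

Definition spectral_fun f : R -> R := fun l => inner (E l f) f.

Lemma spectral_funB f l m : l <= m ->
  spectral_fun f m - spectral_fun f l = Lpnorm 2%:E (E m f - E l f) ^+ 2.
Proof.
move=> lm.
have EE a b : inner (E a f) (E b f) = spectral_fun f (Num.min a b).
  by rewrite -proj_sym (inner_ae _ (proj_min E b a f)) minC.
rewrite -innerff innerBl ![inner _ (_ - _)]innerC !innerBl !EE.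
by rewrite !minxx (min_idPl lm) (min_idPr lm) subrr subr0.
Qed.

Lemma spectral_fun_nondecreasing f : {homo spectral_fun f : l m / l <= m}.
Proof. by move=> l m lm; rewrite -subr_ge0 spectral_funB// sqr_ge0. Qed.

Lemma spectral_fun_right_continuous f l :
  spectral_fun f m @[m --> l^'+] --> spectral_fun f l.
Proof.
apply/subr_cvg0.
have : (Lpnorm 2%:E (E m f - E l f) ^+ 2) @[m --> l^'+] --> (0 : R).
  rewrite -[X in _ --> X](expr0n R 2) !expr2; under eq_fun do rewrite expr2.
  apply: cvgM; exact: proj_right_continuous.
apply: cvg_trans; apply: near_eq_cvg; near=> m.
by rewrite spectral_funB//; apply: ltW; near: m; exact: nbhs_right_gt.
Unshelve. all: by end_near. Qed.

HB.instance Definition _ f := isCumulative.Build R _ R (spectral_fun f)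
  (@spectral_fun_nondecreasing f) (@spectral_fun_right_continuous f).

(* the measure d(E_lambda f, f) *)
Definition spectral_measure f := lebesgue_stieltjes_measure (spectral_fun f).

(* \int_0^n phi(lambda) d(E_lambda f, u), by polarization *)
Definition spectral_pairing (phi : R -> R) (n : nat) f u : R :=
  4^-1 * (\int[spectral_measure (f + u)]_(l in `[0%R, n%:R]) phi l
          - \int[spectral_measure (f - u)]_(l in `[0%R, n%:R]) phi l).

(* Graph of phi(A) = \int_0^{+oo} phi(lambda) dE_lambda, for phi continuous on
   [0, +oo[: the integral is taken weakly, against every u in L^2(mu).  It is
   the limit of the integrals over [0, n] because the two polarized integrals
   over [0, +oo[ may be separately infinite. *)
Definition spectral_integral (phi : R -> R) f h : Prop :=
  (\int[spectral_measure f]_(l in `[0%R, +oo[) (`|phi l| ^+ 2)%:E < +oo)%E /\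
  forall u, spectral_pairing phi n f u @[n --> \oo] --> inner h u.

End spectral_integral.

Definition spectral_resolution_of (B : L2 mu -> L2 mu -> Prop)
    (E : spectral_resolution) :=
  forall f h, B f h <-> spectral_integral E idfun f h.

(* B is the graph of the operator: B f h means that f is in its domain and is
   mapped to h. *)
Definition super_poincare (B : L2 mu -> L2 mu -> Prop) (beta : R -> R) :=
  forall f h, B f h -> (f : T -> R) \in Lfun mu 1 -> forall t, 0 < t ->
  Lpnorm 2%:E f ^+ 2 <= t * inner h f + beta t * Lpnorm 1 f ^+ 2.

End L2.

Section Bernstein.
Context {R : realType}.
Implicit Types (g Psi gamma : R -> R).

Definition posR : set R := `]0, +oo[%classic.

Definition bernstein g :=
  [/\ forall s, 0 < s -> 0 < g s,
      forall n s, 0 < s -> derivable (derive1n n g) s 1 &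
      forall n s, (1 <= n)%N -> 0 < s -> 0 <= (-1) ^+ n.-1 * derive1n n g s].

(* g(0) := g(0+) *)
Definition extend0 g (s : R) : R :=
  if 0 < s then g s else lim (g x @[x --> 0^'+]).

Definition legendre Psi (x : R) : \bar R :=
  ereal_sup [set (x * y - Psi y)%:E | y in posR].

Definition rate gamma Psi (t : R) : R :=
  inf [set e^-1 *
       gamma (e * t * pinv posR (legendre Psi) ((1 - e) / (e * t))%:E)
      | e in `]0, 1[%classic].

End Bernstein.

(* Main.v *)
Require Import Defs.
From mathcomp Require Import all_boot all_order all_algebra.
From mathcomp Require Import all_classical all_reals all_analysis.
From mathcomp Require Import measurable_realfun.
From mathcomp Require Import ring lra.
Import Order.TTheory GRing.Theory Num.Theory.
Import numFieldNormedType.Exports.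
Local Open Scope classical_set_scope.
Local Open Scope ring_scope.

(** Write nu_f for the measure d(E_l f, f), Psi for the inverse of g and Psi*
    for the Legendre transform of Psi.  Whenever x > 0, the definition of
    Psi* as a supremum, taken at y = g(l), is the pointwise inequality
    x g(l) <= l + Psi*(x), valid for every l > 0 and, since g(0+) = 0, for
    l = 0 ([extend0_legendre]).  Integrating it against nu_f yields, for f in
    the domain of A,
      x (g(A) f, f) <= (A f, f) + Psi*(x) ||f||^2,
    which stands in for Jensen's inequality.  Insert this in the
    super-Poincare inequality of g(A) at r = e t x, where x is chosen so that
    Psi*(x) = (1 - e) / (e t): the term in ||f||^2 on the right has
    coefficient 1 - e and is absorbed by the left-hand side ([absorb]).
    Dividing by e and taking the infimum over e in ]0, 1[ gives the rate.

    The substance of the proof is that g(A) f exists for f in the domain of A.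
    The pointwise inequality gives g(l) <= C (l + 1), hence the finiteness of
    the integral of g^2 against nu_f ([sqr_integral_affine_growth]); from
    there a vector of L^2 representing the spectral integral has to be built
    ([spectral_integral_ex]).  As g is increasing, the set where g > c is a
    ray ]a(c), +oo[, so g is the pointwise limit of the staircases
    delta * #{j < N : j delta < g}, which are linear combinations of
    indicators of rays.  The spectral integral of the indicator of ]a, +oo[ is
    f - E_a f; it is thus explicit for staircases, and the squared norm of the
    spectral integral of a step function is bounded by the integral of its
    square against nu_f ([stepv_sq_le]).  By dominated convergence the
    staircases converge to g in L^2(nu_f), so that their spectral integrals
    form a Cauchy sequence; its limit in L^2(mu), which exists by completeness
    ([L2_complete]), is g(A) f. *)

(** * The inner product of L^2 *)

Section inner_product.
Context {d : measure_display} {T : measurableType d} {R : realType}.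
Context {mu : {measure set T -> \bar R}}.
Implicit Types f g h u v : L2 mu.

Lemma innerDr f g h : inner h (f + g) = inner h f + inner h g.
Proof. by rewrite !(innerC h) innerDl. Qed.

Lemma innerZr a f h : inner h (a *: f) = a * inner h f.
Proof. by rewrite !(innerC h) innerZl. Qed.

Lemma innerBr f g h : inner h (f - g) = inner h f - inner h g.
Proof. by rewrite !(innerC h) innerBl. Qed.

Lemma inner0l f : inner 0 f = 0.
Proof. by rewrite -(scale0r 0) innerZl mul0r. Qed.

Lemma inner_ge0 f : 0 <= inner f f.
Proof. by rewrite innerff sqr_ge0. Qed.

Lemma inner_EFin f : (inner f f)%:E = (\int[mu]_x (f x ^+ 2)%:E)%E.
Proof.
rewrite /inner /Rintegral fineK; first by apply: eq_integral => x _; rewrite expr2.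
exact: integrable_fin_num (inner_integrable f f).
Qed.

Lemma inner_cauchy_schwarz f g : inner f g ^+ 2 <= inner f f * inner g g.
Proof.
(* when (g, g) = 0, positivity of f - (t / 2) g for all t forces (f, g) = 0 *)
have [g0|g0] := eqVneq (inner g g) 0.
  have key t : 0 <= inner f f - t * inner f g.
    have := inner_ge0 (f - (t / 2) *: g).
    rewrite innerBl !innerBr !innerZl !innerZr (innerC g f) g0; lra.
  have [->|fg0] := eqVneq (inner f g) 0; first by rewrite expr0n/= g0 mulr0.
  by have := key ((inner f f + 1) / inner f g); rewrite divfK//; lra.
have gp : 0 < inner g g by rewrite lt_def g0 inner_ge0.
have := inner_ge0 (inner g g *: f - inner f g *: g).
rewrite innerBl !innerBr !innerZl !innerZr (innerC g f) => H.
rewrite -subr_ge0 -(pmulr_rge0 _ gp); apply: le_trans H _.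
by rewrite le_eqVlt; apply/orP; left; apply/eqP; ring.
Qed.

(** Strong convergence implies weak convergence. *)
Lemma inner_cvg_sq (s : nat -> L2 mu) f :
  inner (s n - f) (s n - f) @[n --> \oo] --> 0 ->
  forall u, inner (s n) u @[n --> \oo] --> inner f u.
Proof.
move=> s0 u; apply/subr_cvg0.
have H : (Num.sqrt (inner (s n - f) (s n - f) * inner u u)) @[n --> \oo] --> (0 : R).
  rewrite -[X in _ --> X]sqrtr0; apply: (continuous_cvg _ (@sqrt_continuous _ _)).
  by rewrite -(mul0r (inner u u)); apply: cvgMr_tmp.
apply/norm_cvg0P; apply: squeeze_cvgr H; last exact: cvg_cst.
near=> n; rewrite normr_ge0/= -innerBl -(sqrtr_sqr (inner _ u)).
by rewrite ler_sqrt ?inner_cauchy_schwarz// mulr_ge0// inner_ge0.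
Unshelve. all: by end_near. Qed.

End inner_product.

(** * Completeness of L^2 *)

Section completeness.
Context {d : measure_display} {T : measurableType d} {R : realType}.
Context {mu : {measure set T -> \bar R}}.
Local Notation sq f := (inner (f : L2 mu) f).

Lemma L2_mfun (f : L2 mu) : measurable_fun setT f.
Proof. by []. Qed.

Lemma sqr_Lfun2 (f : T -> R) : measurable_fun setT f ->
  (\int[mu]_x (f x ^+ 2)%:E < +oo)%E -> f \in Lfun mu 2%:E.
Proof.
move=> mf foo; rewrite inE; apply/andP; split; rewrite inE//= /finite_norm.
apply: (@lty_poweRy _ _ 2); first by [].
rewrite poweR_Lnorm//; apply: le_lt_trans foo.
rewrite le_eqVlt; apply/orP; left; apply/eqP; apply: eq_integral => x _ /=.
by rewrite powR_mulrn// real_normK ?num_real.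
Qed.

(** The increments D_n have squared norms at most 8^-n, so the sum of the
    4^n D_n^2 has a finite integral, hence is finite almost everywhere; where
    it is finite, D_n is bounded by a constant times 2^-n and the sequence
    converges.  Weighting the squares in this way dispenses with Minkowski's
    inequality. *)
Lemma L2_rapid_ae_cvg (s : nat -> L2 mu) :
  (forall n, sq (s n.+1 - s n) <= 8^-1 ^+ n) ->
  {ae mu, forall x, cvgn (fun n => s n x)}.
Proof.
move=> s8; pose D n : L2 mu := s n.+1 - s n.
pose w n x : \bar R := (4 ^+ n * (D n x ^+ 2))%:E.
have w0 n x : (0 <= w n x)%E by rewrite lee_fin mulr_ge0 ?sqr_ge0 ?exprn_ge0.
have mw n : measurable_fun setT (w n).
  apply/measurable_EFinP/measurable_funM => //.
  by apply: measurable_funX; exact: L2_mfun.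
have iw : (\int[mu]_x (\sum_(n <oo) w n x) < +oo)%E.
  rewrite integral_nneseries//.
  apply: (@le_lt_trans _ _ (\sum_(n <oo) (2^-1 ^+ n)%:E)%E).
    apply: lee_nneseries => n _; first by move=> _; exact: integral_ge0.
    rewrite /w; under eq_integral do rewrite EFinM.
    rewrite ge0_integralZl//; first last.
    - by move=> x _; rewrite lee_fin sqr_ge0.
    - apply/measurable_EFinP.
      by apply: measurable_funX; exact: L2_mfun.
    rewrite -inner_EFin -EFinM lee_fin.
    apply: (@le_trans _ _ (4 ^+ n * 8^-1 ^+ n)).
      by apply: ler_wpM2l; [exact: exprn_ge0|exact: s8].
    by rewrite -exprMn (_ : 4 * 8^-1 = 2^-1 :> R)//; lra.
  apply: (@le_lt_trans _ _ 2%:E); last exact: ltry.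
  apply: lime_le.
    by apply: is_cvg_nneseries => n _ _; rewrite lee_fin exprn_ge0// invr_ge0.
  apply: nearW => n; rewrite sumEFin lee_fin.
  suff -> : \sum_(0 <= i < n) 2^-1 ^+ i = 2 - 2 * 2^-1 ^+ n :> R.
    by rewrite lerBlDr lerDl mulr_ge0// exprn_ge0// invr_ge0.
  elim: n => [|n IH]; first by rewrite big_geq// expr0; lra.
  by rewrite big_nat_recr//= IH exprS; lra.
have mS : measurable_fun setT (fun x => \sum_(n <oo) w n x)%E.
  by apply: ge0_emeasurable_sum.
have iS : mu.-integrable setT (fun x => \sum_(n <oo) w n x)%E.
  apply/integrableP; split => //.
  by under eq_integral do rewrite gee0_abs ?nneseries_ge0//.
have := integrable_ae measurableT iS; apply: filterS => x /(_ I) Sx.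
pose C := fine (\sum_(n <oo) w n x)%E.
have wC n : 4 ^+ n * (D n x ^+ 2) <= C.
  rewrite -lee_fin fineK//; apply: le_trans (nneseries_lim_ge n.+1 _); last first.
    by move=> ? _ _; exact: w0.
  by rewrite big_nat_recr//= leeDr// sume_ge0.
have C0 : 0 <= C by apply: le_trans (wC 0%N); rewrite mulr_ge0 ?sqr_ge0.
have DC n : `|D n x| <= geometric (Num.sqrt C) 2^-1 n.
  rewrite /= -ler_sqr ?nnegrE// ?mulr_ge0 ?sqrtr_ge0 ?exprn_ge0 ?invr_ge0//.
  rewrite real_normK ?num_real// exprMn sqr_sqrtr// -exprM mulnC exprM.
  rewrite (_ : 2^-1 ^+ 2 = 4^-1); last by lra.
  by rewrite exprVn ler_pdivlMr ?exprn_gt0// mulrC; exact: wC.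
have cD : cvgn (series (fun n => D n x)).
  apply: normed_cvg; apply: (series_le_cvg _ _ DC).
  - by [].
  - by move=> n; apply: le_trans (DC n).
  - by apply: is_cvg_geometric_series; rewrite ger0_norm; lra.
have -> : (fun n => s n x) = (fun n => s 0%N x + series (fun n => D n x) n).
  apply/funext => n; rewrite [LHS](eq_sum_telescope (fun n => s n x)).
  by [].
by apply: is_cvgD => //; exact: is_cvg_cst.
Qed.

(** A rapidly convergent subsequence has an almost everywhere limit, and
    Fatou's lemma along this subsequence bounds the distance of every term of
    the whole sequence to that limit. *)
Theorem L2_complete (s : nat -> L2 mu) :
  (forall e, 0 < e -> exists N, forall m n, (N <= m)%N -> (N <= n)%N ->
     sq (s m - s n) < e) ->
  exists h : L2 mu, sq (s n - h) @[n --> \oo] --> (0 : R).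
Proof.
move=> cauchy_s.
have /choice[N NP] : forall k, exists N, forall m n, (N <= m)%N -> (N <= n)%N ->
    sq (s m - s n) < 8^-1 ^+ k by move=> k; apply: cauchy_s; rewrite exprn_gt0.
(* nondecreasing, unbounded, and beyond the rank N k *)
pose phi k := (k + \sum_(i < k.+1) N i)%N.
have phi_ge k : (k <= phi k)%N by rewrite leq_addr.
have phi_geN k : (N k <= phi k)%N by rewrite /phi big_ord_recr/= addnA leq_addl.
have phiS k : (phi k <= phi k.+1)%N.
  by rewrite /phi [in leqRHS]big_ord_recr/= leq_add// leq_addr.
pose t k := s (phi k).
have t_cvg : {ae mu, forall x, cvgn (fun k => t k x)}.
  apply: L2_rapid_ae_cvg => k; apply/ltW/NP => //.
  exact: leq_trans (phi_geN k) (phiS k).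
(* the upper limit is measurable without any care for the null set where the
   subsequence diverges *)
pose h x := fine (limn_esup (fun k => (t k x)%:E)).
have mh : measurable_fun setT h.
  apply: measurableT_comp => //; apply: measurable_fun_limn_esup => k.
  by apply/measurable_EFinP; exact: L2_mfun.
have h_lim x : cvgn (fun k => t k x) -> t k x @[k --> \oo] --> h x.
  move=> cx; rewrite /h is_cvg_limn_esupE; last first.
    apply/cvg_ex; exists (limn (fun k => t k x))%:E.
    by apply: cvg_EFin; [exact: nearW|exact: cx].
  have -> : limn (fun k => (t k x)%:E) = (limn (fun k => t k x))%:E by exact: EFin_lim.
  exact: cx.
have close m e M : (forall n, (M <= n)%N -> sq (s m - s n) <= e) ->
    (\int[mu]_x ((s m x - h x) ^+ 2)%:E <= e%:E)%E.
  move=> mMe; pose u k x := ((s m x - t (k + M)%N x) ^+ 2)%:E.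
  have mu_ k : measurable_fun setT (u k).
    apply/measurable_EFinP/measurable_funX/measurable_funB; exact: L2_mfun.
  apply: (@le_trans _ _ (\int[mu]_x limn_einf (u ^~ x))%E).
    rewrite le_eqVlt; apply/orP; left; apply/eqP; apply: ge0_ae_eq_integral => //.
    - by apply/measurable_EFinP/measurable_funX/measurable_funB => //; exact: L2_mfun.
    - rewrite /limn_einf; apply: measurableT_comp => //.
      by apply: measurable_fun_limn_esup => k; exact: measurableT_comp.
    - by move=> x _; rewrite lee_fin sqr_ge0.
    - move=> x _; rewrite limn_einf_lim; apply: lime_ge; first exact: is_cvg_einfs.
      apply: nearW => k; apply: le_ereal_inf_tmp => _ [j /= _ <-].
      by rewrite lee_fin sqr_ge0.
    - apply: filterS t_cvg => x /h_lim tx _.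
      apply/esym/(fun H => (cvg_limn_einf_sup H).1).
      apply: cvg_EFin; first exact: nearW.
      have tx' : t (k + M)%N x @[k --> \oo] --> h x.
        by move: tx; rewrite -(cvg_shiftn M).
      have dx : (s m x - t (k + M)%N x) @[k --> \oo] --> s m x - h x.
        by apply: cvgB => //; exact: cvg_cst.
      rewrite /comp /= expr2; under eq_cvg do rewrite expr2.
      exact: cvgM.
  apply: le_trans (fatou mu measurableT mu_ _) _.
    by move=> k x _; rewrite lee_fin sqr_ge0.
  rewrite limn_einf_lim; apply: lime_le; first exact: is_cvg_einfs.
  apply: nearW => k; apply: le_trans (ereal_inf_lbound _) _; first by exists k => /=.
  rewrite /u -(inner_EFin (s m - t (k + M)%N)) lee_fin; apply: mMe.
  exact: leq_trans (leq_addl _ _) (phi_ge _).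
have h2 : h \in Lfun mu 2%:E.
  have [M MP] := cauchy_s 1 ltr01.
  have hs : (fun x => s M x - h x) \in Lfun mu 2%:E.
    apply: sqr_Lfun2; first by apply: measurable_funB => //; exact: L2_mfun.
    apply: (@le_lt_trans _ _ 1%:E); last exact: ltry.
    by apply: (close M 1 M) => n Mn; apply/ltW/MP.
  have -> : h = (s M - Lfun_Sub (lee1n 2) hs : L2 mu).
    by apply/funext => x /=; rewrite subKr.
  exact: LfunP.
exists (Lfun_Sub (lee1n 2) h2).
apply/cvgrPdist_le => e e0; have [M MP] := cauchy_s e e0.
exists M => // m /= Mm; rewrite sub0r normrN ger0_norm ?inner_ge0//.
rewrite -lee_fin inner_EFin; apply: (close m e M) => n Mn.
exact/ltW/MP.
Qed.

End completeness.

(** * The measures d(E_l f, f) *)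

Section spectral.
Context {d : measure_display} {T : measurableType d} {R : realType}.
Context {mu : {measure set T -> \bar R}} {E : spectral_resolution mu}.
Implicit Types (f u v : L2 mu) (l m a : R).
Local Notation F := (spectral_fun E).
Local Notation nu := (spectral_measure E).

Lemma inner_projD l f g v : inner (E l (f + g)) v = inner (E l f) v + inner (E l g) v.
Proof.
have := proj_linear E l 1 f g; rewrite !scale1r => H.
by rewrite (inner_ae v H) innerDl.
Qed.

Lemma inner_projN l f v : inner (E l (- f)) v = - inner (E l f) v.
Proof.
have H0 : inner (E l 0) v = 0.
  by have := inner_projD l 0 0 v; rewrite addr0; lra.
have := inner_projD l f (- f) v; rewrite subrr H0; lra.
Qed.

Lemma inner_projB l f g v : inner (E l (f - g)) v = inner (E l f) v - inner (E l g) v.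
Proof. by rewrite inner_projD inner_projN. Qed.

Lemma inner_proj2 l m f v : inner (E l f) (E m v) = inner (E (Num.min l m) f) v.
Proof. by rewrite -proj_sym (inner_ae v (proj_min E m l f)) minC. Qed.

Lemma spectral_fun_polarization l f u :
  F (f + u) l - F (f - u) l = 4 * inner (E l f) u.
Proof.
rewrite /spectral_fun !(inner_projB, inner_projD) !(innerBr, innerDr).
have -> : inner (E l u) f = inner (E l f) u by rewrite proj_sym innerC.
lra.
Qed.

(** This is (f - E_l f, f - E_l f) >= 0, as E_l is an orthogonal projection. *)
Lemma spectral_fun_le f l : F f l <= inner f f.
Proof.
have := inner_ge0 (f - E l f); rewrite innerBl !innerBr inner_proj2 minxx.
rewrite (innerC f) /spectral_fun; lra.
Qed.

Lemma spectral_fun_lt0 f l : l < 0 -> F f l = 0.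
Proof.
move=> l0; have E0 : E l f = (0 : L2 mu) %[ae mu] by exact: proj_lt0.
by rewrite /spectral_fun (inner_ae f E0) inner0l.
Qed.

Lemma inner_proj_cvg f u : inner f (E n%:R u) @[n --> \oo] --> inner f u.
Proof.
have H : Lpnorm mu 2%:E (E n%:R u - u) @[n --> \oo] --> (0 : R).
  by apply: (cvg_comp _ _ (@cvgr_idn R)) (proj_cvg E u).
have H2 : inner (E n%:R u - u) (E n%:R u - u) @[n --> \oo] --> (0 : R).
  have -> : (fun n : nat => inner (E n%:R u - u) (E n%:R u - u)) =
      (fun n : nat => Lpnorm mu 2%:E (E n%:R u - u) * Lpnorm mu 2%:E (E n%:R u - u)).
    by apply/funext => n; rewrite innerff expr2.
  have HH := cvgM H H; rewrite mul0r in HH; exact: HH.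
rewrite innerC; under eq_cvg do rewrite innerC.
exact: inner_cvg_sq H2 f.
Qed.

Lemma spectral_measure_oc f a b : a <= b -> nu f `]a, b] = (F f b - F f a)%:E.
Proof.
move=> ab; rewrite /spectral_measure/= /lebesgue_stieltjes_measure/= /measure_extension/=.
rewrite measurable_mu_extE/=; last exact: is_ocitv.
by rewrite wlength_itv_bnd.
Qed.

(** Exhaust the half-line by the intervals ]-1, n]; starting at -1 rather than
    at 0 keeps the possible atom at 0, that is, the kernel of the operator. *)
Lemma spectral_measure_le f : (nu f `[0%R, +oo[ <= (inner f f)%:E)%E.
Proof.
pose B n : set R := `]-1, n%:R]%classic.
have Bcvg : nu f (B n) @[n --> \oo] --> nu f (\bigcup_n B n).
  apply: nondecreasing_cvg_mu.
  - by move=> n; exact: measurable_itv.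
  - by apply: bigcup_measurable => n _; exact: measurable_itv.
  - move=> m n mn; apply/subsetPset => x; rewrite /B /= !in_itv/= => /andP[-> xm].
    by apply: le_trans xm _; rewrite ler_nat.
apply: (@le_trans _ _ (nu f (\bigcup_n B n))).
  apply: le_measure; rewrite ?inE//.
  - by apply: bigcup_measurable => n _; exact: measurable_itv.
  - move=> x /=; rewrite in_itv/= andbT => x0.
    exists (Num.bound x) => //; rewrite /B/= in_itv/= (lt_le_trans _ x0) ?ltrN10//=.
    by apply/ltW; exact: archi_boundP.
rewrite -(cvg_lim _ Bcvg)//; apply: lime_le; first by apply/cvg_ex; eexists; exact: Bcvg.
apply: nearW => n; rewrite spectral_measure_oc.
  by rewrite lee_fin (spectral_fun_lt0 f _ (ltrN10 R)) subr0 spectral_fun_le.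
by rewrite (le_trans (lerN10 R)).
Qed.

Lemma spectral_measure_fin f (D : set R) : measurable D -> D `<=` `[0%R, +oo[ ->
  (nu f D < +oo)%E.
Proof.
move=> mD D0; apply: (@le_lt_trans _ _ (inner f f)%:E); last exact: ltry.
apply: le_trans (spectral_measure_le f); apply: le_measure; rewrite ?inE//.
Qed.

End spectral.

(** * Spectral integrals of step functions *)

Section steps.
Context {d : measure_display} {T : measurableType d} {R : realType}.
Context {mu : {measure set T -> \bar R}} {E : spectral_resolution mu}.
Implicit Types (f u v : L2 mu) (l m a b : R) (s t : seq (R * R)).
Local Notation F := (spectral_fun E).
Local Notation nu := (spectral_measure E).

(** A list of pairs (c, a) stands for the combination of the indicators of the
    rays ]a, +oo[ with coefficients c.  Rays open on the left are the ones whose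
    spectral projection 1 - E_a involves no left limit of E. *)
Definition step s l : R := \sum_(p <- s) p.1 * (p.2 < l)%R%:R.

(** The spectral integral of [step s], applied to f. *)
Definition stepv s f : L2 mu := \sum_(p <- s) p.1 *: (f - E p.2 f).

Lemma inner_suml I (r : seq I) (h : I -> L2 mu) v :
  inner (\sum_(i <- r) h i) v = \sum_(i <- r) inner (h i) v.
Proof.
elim: r => [|i r IH]; first by rewrite !big_nil inner0l.
by rewrite !big_cons innerDl IH.
Qed.

Lemma step_cons p s l : step (p :: s) l = p.1 * (p.2 < l)%R%:R + step s l.
Proof. by rewrite /step big_cons. Qed.

Lemma step_cat s t l : step (s ++ t) l = step s l + step t l.
Proof. by rewrite /step big_cat. Qed.

Lemma stepv_cat s t f : stepv (s ++ t) f = stepv s f + stepv t f.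
Proof. by rewrite /stepv big_cat. Qed.

Definition negstep s := [seq (- p.1, p.2) | p <- s].

Lemma step_neg s l : step (negstep s) l = - step s l.
Proof.
rewrite /step big_map -sumrN; apply: eq_bigr => p _ /=; by rewrite mulNr.
Qed.

Lemma stepv_neg s f : stepv (negstep s) f = - stepv s f.
Proof. by rewrite /stepv big_map -sumrN; apply: eq_bigr => p _ /=; rewrite scaleNr. Qed.

Lemma measurable_step s : measurable_fun setT (step s).
Proof.
apply: measurable_sum => p; apply: measurable_funM => //.
rewrite (_ : (fun l => _) = \1_(`]p.2, +oo[%classic : set R)).
  exact: measurable_indic.
by apply/funext => l; rewrite indicE mem_setE in_itv/= andbT.
Qed.

Lemma itv0n_sub n : `[0%R, n%:R]%classic `<=` (`[0%R, +oo[%classic : set R).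
Proof. by move=> x /=; rewrite !in_itv/= => /andP[->]. Qed.

Lemma integrable_bnd f (D : set R) (phi : R -> R) (M : R) :
  measurable D -> D `<=` `[0%R, +oo[ -> measurable_fun setT phi ->
  (forall l, D l -> `|phi l| <= M) -> (nu f).-integrable D (EFin \o phi).
Proof.
move=> mD D0 mphi phiM; apply: measurable_bounded_integrable => //.
- exact: spectral_measure_fin.
- exact: measurable_funS mphi.
- exists M; split; first exact: num_real.
  by move=> x Mx l Dl; apply: le_trans (phiM l Dl) (ltW Mx).
Qed.

Lemma step_bounded s : exists M, forall l, `|step s l| <= M.
Proof.
exists (\sum_(p <- s) `|p.1|) => l; apply: le_trans (ler_norm_sum _ _ _) _.
by apply: ler_sum => p _; rewrite normrM ler_piMr// normr_nat lern1 leq_b1.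
Qed.

Lemma integrable_step f n s : (nu f).-integrable `[0%R, n%:R] (EFin \o step s).
Proof.
have [M sM] := step_bounded s.
apply: (@integrable_bnd _ _ _ M) => //; first exact: itv0n_sub.
exact: measurable_step.
Qed.

Lemma integral_ray f n a : 0 <= a ->
  \int[nu f]_(l in `[0%R, n%:R]) (a < l)%R%:R = F f n%:R - F f (Num.min a n%:R).
Proof.
move=> a0; under eq_Rintegral => l _.
  have -> : (a < l)%R%:R = \1_(`]a, +oo[%classic : set R) l :> R.
    by rewrite indicE mem_setE in_itv/= andbT.
  over.
rewrite /Rintegral integral_indic//.
have -> : `]a, +oo[%classic `&` `[0%R, n%:R]%classic =
    `](Num.min a n%:R), n%:R]%classic :> set R.
  apply/seteqP; split => x /=; rewrite !in_itv/= andbT.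
    by move=> [ax /andP[x0 xn]]; rewrite xn gt_min ax.
  move=> /andP[]; rewrite gt_min => /orP[ax|/lt_geF->]// xn.
  by rewrite ax xn (le_trans a0 (ltW ax)).
have mn : Num.min a n%:R <= n%:R :> R by rewrite ge_min lexx orbT.
exact: (congr1 fine (spectral_measure_oc (E := E) f _ _ mn)).
Qed.

Definition knots_ge0 s := forall p, p \in s -> 0 <= p.2.

Lemma integral_step f n s : knots_ge0 s ->
  \int[nu f]_(l in `[0%R, n%:R]) step s l =
  \sum_(p <- s) p.1 * (F f n%:R - F f (Num.min p.2 n%:R)).
Proof.
elim: s => [|p s IH] s0.
  rewrite big_nil; under eq_Rintegral do rewrite /step big_nil.
  by rewrite Rintegral_cst// mul0r.
rewrite big_cons -IH; last by move=> q qs; apply: s0; rewrite inE qs orbT.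
rewrite -integral_ray; last by apply: s0; rewrite inE eqxx.
have iray : (nu f).-integrable `[0%R, n%:R] (fun l => (p.2 < l)%R%:R%:E).
  have := integrable_step f n [:: (1, p.2)]; apply: eq_integrable => //= l _ /=.
  by rewrite /step big_seq1 mul1r.
rewrite -RintegralZl// -RintegralD//.
- by apply: eq_Rintegral => l _; rewrite step_cons.
- have := integrable_step f n [:: p]; apply: eq_integrable => //= l _ /=.
  by rewrite /step big_seq1.
- exact: integrable_step.
Qed.

(** The cut-off of the integral at n becomes the projection E_n, and the
    polarization built in [spectral_pairing] undoes itself on each ray. *)
Lemma pairing_step n s f u : knots_ge0 s ->
  spectral_pairing E (step s) n f u = inner (stepv s f) (E n%:R u).
Proof.
move=> s0; rewrite /spectral_pairing !integral_step// -sumrB mulr_sumr inner_suml.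
apply: eq_bigr => p _; rewrite -mulrBr innerZl innerBl inner_proj2 -proj_sym.
have := spectral_fun_polarization (E := E) n%:R f u.
have := spectral_fun_polarization (E := E) (Num.min p.2 n%:R) f u.
move=> /eqP; rewrite subr_eq => /eqP ->; move=> /eqP; rewrite subr_eq => /eqP ->.
by field.
Qed.

Lemma inner_step_proj n a b f :
  inner (f - E a f) (E n%:R (f - E b f)) =
  F f n%:R - F f (Num.min (Num.max a b) n%:R).
Proof.
rewrite -proj_sym innerBr !inner_projB inner_proj2.
rewrite (inner_ae f (proj_min E n%:R a f)) (inner_ae (E b f) (proj_min E n%:R a f)).
rewrite inner_proj2 /spectral_fun.
by rewrite -minA [Num.min _ n%:R]minC; case: (leP a b) => _; lra.
Qed.

(** The square of a step function is again a step function: the intersection of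
    the rays from a and from b is the ray from max a b, on the spectral side as
    well ([inner_step_proj]). *)
Lemma stepv_proj_sq n s f : knots_ge0 s ->
  inner (stepv s f) (E n%:R (stepv s f)) =
  \int[nu f]_(l in `[0%R, n%:R]) (step s l ^+ 2).
Proof.
move=> s0; pose s2 := [seq (p.1 * q.1, Num.max p.2 q.2) | p <- s, q <- s].
have s20 : knots_ge0 s2.
  by move=> _ /allpairsP[[p q] /= [ps qs ->]] /=; rewrite le_max s0.
have -> : \int[nu f]_(l in `[0%R, n%:R]) (step s l ^+ 2) =
    \int[nu f]_(l in `[0%R, n%:R]) step s2 l.
  apply: eq_Rintegral => l _.
  rewrite expr2 /step /s2 big_allpairs_dep mulr_suml; apply: eq_bigr => p _.
  rewrite mulr_sumr; apply: eq_bigr => q _ /=.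
  by rewrite gt_max mulrACA -natrM mulnb.
rewrite integral_step// /s2 big_allpairs_dep inner_suml; apply: eq_bigr => p _.
rewrite innerZl -proj_sym innerC inner_suml mulr_sumr; apply: eq_bigr => q _ /=.
by rewrite innerZl inner_step_proj mulrA maxC.
Qed.

(** Let n tend to infinity in [stepv_proj_sq]. *)
Lemma stepv_sq_le s f : knots_ge0 s ->
  ((inner (stepv s f) (stepv s f))%:E <=
   \int[nu f]_(l in `[0%R, +oo[) (step s l ^+ 2)%:E)%E.
Proof.
move=> s0.
have H : (inner (stepv s f) (E n%:R (stepv s f)))%:E @[n --> \oo] -->
    (inner (stepv s f) (stepv s f))%:E.
  by apply: cvg_EFin; [exact: nearW|exact: inner_proj_cvg].
have m2 : measurable_fun setT (fun l => (step s l ^+ 2)%:E).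
  by apply/measurable_EFinP/measurable_funX; exact: measurable_step.
rewrite -(cvg_lim _ H)//; apply: lime_le; first by apply/cvg_ex; eexists; exact: H.
apply: nearW => n; rewrite stepv_proj_sq// /Rintegral fineK; last first.
  have [M sM] := step_bounded s.
  apply: integrable_fin_num => //; apply: (@integrable_bnd _ _ _ (M ^+ 2)) => //.
  - exact: itv0n_sub.
  - by apply/measurable_funX; exact: measurable_step.
  - by move=> l _; rewrite normrX lerXn2r// nnegrE// (le_trans _ (sM l)).
apply: ge0_subset_integral => //.
- exact: measurable_funS m2.
- by move=> l _; rewrite lee_fin sqr_ge0.
- exact: itv0n_sub.
Qed.

End steps.

(** * Spectral integrals of nondecreasing functions *)

Section staircase.
Context {R : realType}.

(** The sum is e times the number of j < n with j e < x, that is, the least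
    multiple of e that is at least x, capped at n e. *)
Lemma staircase_bounds (e x : R) n : 0 <= e -> 0 <= x ->
  Num.min x (n%:R * e) <= \sum_(j <- iota 0 n) e * (j%:R * e < x)%R%:R
    <= Num.min (x + e) (n%:R * e).
Proof.
move=> e0 x0; elim: n => [|n IH].
  by rewrite big_nil mul0r !ge_min !le_min lexx orbT /= addr_ge0.
rewrite -[in iota 0 n.+1]addn1 iotaD big_cat/= big_seq1 add0n.
rewrite -[n.+1%:R]natr1 mulrDl mul1r.
move: IH; rewrite !ge_min !le_min => /andP[lb /andP[ub1 ub2]].
case: (ltP (n%:R * e) x) => nx; rewrite ?mulr1 ?mulr0.
  have Se : \sum_(j <- iota 0 n) e * (j%:R * e < x)%R%:R = n%:R * e.
    by apply/eqP; rewrite eq_le ub2/=; case/orP: lb => // lb; lra.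
  rewrite Se lexx orbT/=; lra.
have xS : x <= \sum_(j <- iota 0 n) e * (j%:R * e < x)%R%:R.
  by case/orP: lb => // lb; lra.
rewrite addr0 xS /= ub1 /=; lra.
Qed.

End staircase.

(** The level sets G > c are rays of the kind that step functions are made of,
    with endpoint a(c); this also makes G nondecreasing, hence measurable. *)
Section functional_calculus.
Context {d : measure_display} {T : measurableType d} {R : realType}.
Context {mu : {measure set T -> \bar R}} (E : spectral_resolution mu).
Variables (G a : R -> R).
Hypothesis G_ge0 : forall l, 0 <= G l.
Hypothesis a_ge0 : forall c, 0 <= c -> 0 <= a c.
Hypothesis G_level : forall c l, 0 <= c -> (c < G l) = (a c < l).
Local Notation nu := (spectral_measure E).
Local Notation sq f := (inner (f : L2 mu) f).

(** The staircase of step 1 / (k + 1) and height k + 1 below G: both the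
    refinement of the step and the growth of the cap come from k. *)
Definition stairs k : seq (R * R) :=
  [seq (k.+1%:R^-1, a (j%:R * k.+1%:R^-1)) | j <- iota 0 (k.+1 ^ 2)].

Lemma stairs_knots_ge0 k : knots_ge0 (stairs k).
Proof. by move=> _ /mapP[j _ ->] /=; rewrite a_ge0// mulr_ge0// invr_ge0. Qed.

Lemma step_stairs k l :
  Num.min (G l) k.+1%:R <= step (stairs k) l <= G l + k.+1%:R^-1.
Proof.
have := staircase_bounds k.+1%:R^-1 (G l) (k.+1 ^ 2).
rewrite invr_ge0 ler0n => /(_ isT (G_ge0 l)).
rewrite natrX expr2 mulfK ?pnatr_eq0// => /andP[lb ub].
have -> : step (stairs k) l = \sum_(j <- iota 0 (k.+1 ^ 2))
    k.+1%:R^-1 * (j%:R * k.+1%:R^-1 < G l)%R%:R.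
  rewrite /step big_map; apply: eq_bigr => j _ /=.
  by rewrite G_level// mulr_ge0// invr_ge0.
by rewrite lb/= (le_trans ub)// ge_min lexx.
Qed.

Lemma stairs_dist k l : `|step (stairs k) l - G l| <= G l + 1.
Proof.
have /andP[lb ub] := step_stairs k l.
have i1 : k.+1%:R^-1 <= 1 :> R by rewrite invf_le1// ler1n.
have s0 : 0 <= step (stairs k) l by apply: le_trans lb; rewrite le_min G_ge0/=.
have G0 := G_ge0 l; rewrite ler_norml.
by move: ub i1; move: (k.+1%:R^-1) => e ub i1; apply/andP; split; lra.
Qed.

Lemma stairs_cvg l : step (stairs k) l @[k --> \oo] --> G l.
Proof.
have i0 : (k.+1%:R^-1 : R) @[k --> \oo] --> (0 : R) by exact: cvg_harmonic.
apply/subr_cvg0/norm_cvg0P; apply: (squeeze_cvgr _ (cvg_cst 0) i0).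
near=> k; rewrite normr_ge0/=; have /andP[lb ub] := step_stairs k l.
have Gk : G l <= k.+1%:R.
  apply: (@le_trans _ _ k%:R); last by rewrite ler_nat.
  near: k; exact: nbhs_infty_ger.
move: lb; rewrite (min_idPl Gk) => lb.
have k0 : 0 <= k.+1%:R^-1 :> R by rewrite invr_ge0.
rewrite ler_norml; move: ub k0.
by move: (k.+1%:R^-1) => e ub k0; apply/andP; split; lra.
Unshelve. all: by end_near. Qed.

Lemma level_nondecreasing : {homo G : l m / l <= m}.
Proof.
move=> l m lm; rewrite leNgt; apply/negP => ml.
have := ml; rewrite (G_level _ _ (G_ge0 m)) => al.
by have := lt_le_trans al lm; rewrite -(G_level _ _ (G_ge0 m)) ltxx.
Qed.

Lemma measurable_level : measurable_fun setT G.
Proof. by apply: nondecreasing_measurable => // l m lm; exact: level_nondecreasing. Qed.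

Lemma integrable_level f n : (nu f).-integrable `[0%R, n%:R] (EFin \o G).
Proof.
apply: (@integrable_bnd _ _ _ _ _ _ _ _ (G n%:R)) => //.
- exact: itv0n_sub.
- exact: measurable_level.
- move=> l /=; rewrite in_itv/= => /andP[_ ln].
  by rewrite ger0_norm//; exact: level_nondecreasing.
Qed.

Lemma integral_stairs_cvg f n :
  \int[nu f]_(l in `[0%R, n%:R]) step (stairs k) l @[k --> \oo] -->
  \int[nu f]_(l in `[0%R, n%:R]) G l.
Proof.
have mD : measurable (`[0%R, n%:R]%classic : set R) by [].
have ms k : measurable_fun (`[0%R, n%:R]%classic : set R) (EFin \o step (stairs k)).
  by apply/measurable_EFinP; apply: measurable_funS (measurable_step (stairs k)).
have mG : measurable_fun (`[0%R, n%:R]%classic : set R) (EFin \o G).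
  by apply/measurable_EFinP; apply: measurable_funS measurable_level.
have ib : (nu f).-integrable `[0%R, n%:R] (EFin \o (fun=> G n%:R + 1)).
  apply: (@integrable_bnd _ _ _ _ _ _ _ _ (G n%:R + 1)) => //.
    exact: itv0n_sub.
  by move=> l _; rewrite ger0_norm// addr_ge0.
have [] := @dominated_convergence _ _ _ (nu f) _ mD _ _ _ ms mG _ ib.
- apply/aeW => l _ /=; apply/cvg_EFin; [exact: nearW|exact: stairs_cvg].
- apply/aeW => l k /=; rewrite in_itv/= => /andP[_ ln] /=.
  have /andP[lb ub] := step_stairs k l.
  have i1 : k.+1%:R^-1 <= 1 :> R by rewrite invf_le1// ler1n.
  rewrite lee_fin ger0_norm; last by apply: le_trans lb; rewrite le_min G_ge0/=.
  have Gn := level_nondecreasing _ _ ln.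
  by move: ub i1; move: (k.+1%:R^-1) => e ub i1; lra.
move=> _ _ H; apply: fine_cvg; rewrite fineK; first exact: H.
exact: integrable_fin_num (integrable_level f n).
Qed.

Variable f : L2 mu.
Hypothesis G2f : (\int[nu f]_(l in `[0%R, +oo[) (`|G l| ^+ 2)%:E < +oo)%E.

Let err k := (\int[nu f]_(l in `[0%R, +oo[) ((step (stairs k) l - G l) ^+ 2)%:E)%E.

(** Dominated convergence, with 2 G^2 + 2 as a dominating function. *)
Lemma stairs_err_cvg0 : err k @[k --> \oo] --> 0%E.
Proof.
have mD : measurable (`[0%R, +oo[%classic : set R) by [].
have ms k : measurable_fun (`[0%R, +oo[%classic : set R)
    (fun l => ((step (stairs k) l - G l) ^+ 2)%:E).
  apply/measurable_EFinP/measurable_funX/measurable_funB.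
    exact: measurable_funS (measurable_step (stairs k)).
  exact: measurable_funS measurable_level.
have iG : (nu f).-integrable `[0%R, +oo[ (fun l => (G l ^+ 2)%:E).
  apply/integrableP; split.
    apply/measurable_EFinP/measurable_funX.
    exact: measurable_funS measurable_level.
  by under eq_integral do rewrite gee0_abs ?lee_fin ?sqr_ge0// -real_normK ?num_real//.
have i2 : (nu f).-integrable `[0%R, +oo[ (EFin \o (fun=> 2)).
  by apply: (@integrable_bnd _ _ _ _ _ _ _ _ 2) => // l _; rewrite ger0_norm.
have ib : (nu f).-integrable `[0%R, +oo[ (fun l => 2%:E * (G l ^+ 2)%:E + 2%:E)%E.
  by apply: integrableD => //; exact: integrableZl.
have [] := @dominated_convergence _ _ _ (nu f) _ mD _ _ _ ms
  (measurable_cst (0%E : \bar R)) _ ib.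
- apply/aeW => l _ /=; apply/cvg_EFin; first exact: nearW.
  have H : (step (stairs k) l - G l) @[k --> \oo] --> (0 : R).
    by apply/subr_cvg0; exact: stairs_cvg.
  have HH := cvgM H H; rewrite mul0r in HH; exact: HH.
- apply/aeW => l k _ /=; rewrite -EFinM -EFinD lee_fin ger0_norm ?sqr_ge0//.
  rewrite -real_normK ?num_real//.
  apply: (@le_trans _ _ ((G l + 1) ^+ 2)).
    by rewrite lerXn2r ?nnegrE ?addr_ge0 ?normr_ge0 ?G_ge0// stairs_dist.
  have := sqr_ge0 (G l - 1); rewrite !expr2; lra.
by move=> _ _; rewrite integral0.
Qed.

Lemma stairs_sqB k m :
  ((sq (stepv (E := E) (stairs k) f - stepv (E := E) (stairs m) f))%:E
    <= 2%:E * err k + 2%:E * err m)%E.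
Proof.
rewrite -stepv_neg -stepv_cat.
apply: le_trans (stepv_sq_le _ _ _) _.
  move=> p; rewrite mem_cat => /orP[|/mapP[q /stairs_knots_ge0 ? ->//]].
  exact: stairs_knots_ge0.
have me j : measurable_fun (`[0%R, +oo[%classic : set R)
    (fun l => ((step (stairs j) l - G l) ^+ 2)%:E).
  apply/measurable_EFinP/measurable_funX/measurable_funB.
    exact: measurable_funS (measurable_step (stairs j)).
  exact: measurable_funS measurable_level.
have m2e j : measurable_fun (`[0%R, +oo[%classic : set R)
    (fun l => 2%:E * ((step (stairs j) l - G l) ^+ 2)%:E)%E.
  exact: measurable_funeM.
rewrite /err -!ge0_integralZl//; try by move=> l _; rewrite lee_fin sqr_ge0.
rewrite -ge0_integralD//; try by move=> l _; rewrite -EFinM lee_fin mulr_ge0// sqr_ge0.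
- apply: ge0_le_integral => //.
  + by move=> l _; rewrite lee_fin sqr_ge0.
  + apply/measurable_EFinP/measurable_funX.
    exact: measurable_funS (measurable_step _).
  + exact: (emeasurable_funD (m2e k) (m2e m)).
  + move=> l _; rewrite step_cat step_neg -!EFinM -EFinD lee_fin.
    have := sqr_ge0 (step (stairs k) l - G l + (step (stairs m) l - G l)).
    rewrite !expr2; lra.
- exact: m2e.
- exact: m2e.
- exact: me.
- exact: me.
Qed.

(** The vector h is the limit of the spectral integrals of the staircases, which
    are Cauchy by [stairs_sqB].  For a fixed cut-off n, both sides of the
    equation are limits of the corresponding expressions for staircases. *)
Theorem spectral_integral_ex : exists h : L2 mu,
  forall n u, spectral_pairing E G n f u = inner h (E n%:R u).
Proof.
have [e e0|h Sh] := L2_complete (fun k => stepv (E := E) (stairs k) f).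
  have /fine_cvgP[efin /cvgrPdist_lt/(_ (e / 4))] := stairs_err_cvg0.
  move=> /(_ ltac:(by rewrite divr_gt0)) He.
  have [N _ NP] : \forall k \near \oo, (err k < (e / 4)%:E)%E.
    near=> k; have kfin : err k \is a fin_num by near: k.
    rewrite -(fineK kfin) lte_fin; apply: le_lt_trans (ler_norm _) _.
    by rewrite -normrN -sub0r; near: k.
  exists N => m n Nm Nn; rewrite -lte_fin; apply: le_lt_trans (stairs_sqB m n) _.
  have -> : e%:E = (2%:E * (e / 4)%:E + 2%:E * (e / 4)%:E)%E.
    by rewrite -!EFinM -EFinD; congr EFin; field.
  by apply: lteD; rewrite lte_pmul2l//; exact: NP.
exists h => n u.
have c1 := inner_cvg_sq _ _ Sh (E n%:R u).
have c2 : spectral_pairing E (step (stairs k)) n f u @[k --> \oo] -->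
    spectral_pairing E G n f u.
  by apply: cvgMl_tmp; apply: cvgB; exact: integral_stairs_cvg.
have e12 : (fun k => spectral_pairing E (step (stairs k)) n f u) =
    (fun k => inner (stepv (E := E) (stairs k) f) (E n%:R u)).
  by apply/funext => k; rewrite pairing_step//; exact: stairs_knots_ge0.
rewrite e12 in c2; exact: (cvg_unique _ c2 c1).
Unshelve. all: by end_near. Qed.

End functional_calculus.

(** * Comparison of spectral integrals *)

Section comparison.
Context {d : measure_display} {T : measurableType d} {R : realType}.
Context {mu : {measure set T -> \bar R}} {E : spectral_resolution mu}.
Local Notation nu := (spectral_measure E).

(** At u = f the second polarized integral is against the spectral measure of
    f - f = 0, so that only one measure is left and the pairing is monotone in
    the integrand. *)
Lemma spectral_pairing_diag (phi : R -> R) n (f : L2 mu) :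
  measurable_fun setT phi ->
  spectral_pairing E phi n f f =
  4^-1 * \int[nu (f + f)]_(l in `[0%R, n%:R]) phi l.
Proof.
move=> mphi.
have nu0 (z : L2 mu) : inner z z = 0 -> nu z `[0%R, n%:R] = 0%E.
  move=> z0; apply/eqP; rewrite eq_le measure_ge0 andbT.
  apply: (@le_trans _ _ (nu z `[0%R, +oo[)).
    by apply: le_measure; rewrite ?inE//; exact: itv0n_sub.
  by have := spectral_measure_le (E := E) z; rewrite z0.
have int0 : \int[nu (0 : L2 mu)]_(l in `[0%R, n%:R]) phi l = 0.
  rewrite /Rintegral null_set_integral//.
    by apply/measurable_EFinP; exact: measurable_funS mphi.
  by apply: nu0; rewrite inner0l.
by rewrite /spectral_pairing (subrr f) int0 subr0.
Qed.

Lemma spectral_pairing_le (phi psi : R -> R) (c x : R) n (f : L2 mu) :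
  {homo phi : l m / l <= m} -> {homo psi : l m / l <= m} -> 0 <= c ->
  (forall l, 0 <= l -> x * phi l <= psi l + c) ->
  x * spectral_pairing E phi n f f <=
  spectral_pairing E psi n f f + c * inner f f.
Proof.
move=> phi_nd psi_nd c0 phipsi.
have mphi : measurable_fun setT phi by exact: nondecreasing_measurable.
have mpsi : measurable_fun setT psi by exact: nondecreasing_measurable.
have i_nd (h : R -> R) : measurable_fun setT h -> {homo h : l m / l <= m} ->
    (nu (f + f)).-integrable `[0%R, n%:R] (EFin \o h).
  move=> mh nd; apply: (@integrable_bnd _ _ _ _ _ _ _ _ (`|h 0| + `|h n%:R|)) => //.
    exact: itv0n_sub.
  move=> l /=; rewrite in_itv/= => /andP[l0 ln].
  have h0 := nd _ _ l0; have hn := nd _ _ ln.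
  have := ler_norm (h n%:R); have := ler_norm (- h 0); rewrite normrN.
  have := normr_ge0 (h n%:R); have := normr_ge0 (h 0).
  by rewrite ler_norml => *; apply/andP; split; lra.
rewrite !spectral_pairing_diag// mulrCA.
have ip := i_nd _ mphi phi_nd; have iq := i_nd _ mpsi psi_nd.
have ic : (nu (f + f)).-integrable `[0%R, n%:R] (EFin \o (fun=> c)).
  by apply: i_nd.
have le1 : x * \int[nu (f + f)]_(l in `[0%R, n%:R]) phi l <=
    \int[nu (f + f)]_(l in `[0%R, n%:R]) psi l +
    \int[nu (f + f)]_(l in `[0%R, n%:R]) c.
  rewrite -RintegralZl// -RintegralD//; apply: le_Rintegral => //.
  - apply: (@integrableZl _ _ _ _ _ _ x _ ip) => //.
  - apply: (@integrableD _ _ _ _ _ _ _ _ iq ic) => //.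
  - by move=> l /=; rewrite in_itv/= => /andP[l0 _]; exact: phipsi.
have le2 : \int[nu (f + f)]_(l in `[0%R, n%:R]) c <= c * (4 * inner f f).
  rewrite Rintegral_cst//; apply: ler_wpM2l => //.
  have -> : 4 * inner f f = inner (f + f) (f + f).
    by rewrite innerDl !innerDr; ring.
  have le3 : (nu (f + f)%R `[0%R, n%:R] <= (inner (f + f)%R (f + f)%R)%:E)%E.
    apply: le_trans (spectral_measure_le (f + f)).
    by apply: le_measure; rewrite ?inE//; exact: itv0n_sub.
  rewrite -lee_fin fineK// fin_numE -ltNye (lt_le_trans ltNy0)//=.
  by rewrite -ltey (le_lt_trans le3)// ltry.
have arith (X Y Z I : R) : X <= Y + Z -> Z <= c * (4 * I) ->
    4^-1 * X <= 4^-1 * Y + c * I by clear => *; lra.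
exact: arith le1 le2.
Qed.

(** From (x phi)^2 <= (l + p)^2 <= 2 l^2 + 2 p^2, as nu_f is finite. *)
Lemma sqr_integral_affine_growth (phi : R -> R) (x p : R) (f : L2 mu) :
  measurable_fun setT phi -> 0 < x ->
  (forall l, 0 <= l -> 0 <= phi l) ->
  (forall l, 0 <= l -> x * phi l <= l + p) ->
  (\int[nu f]_(l in `[0%R, +oo[) (`|l| ^+ 2)%:E < +oo)%E ->
  (\int[nu f]_(l in `[0%R, +oo[) (`|phi l| ^+ 2)%:E < +oo)%E.
Proof.
move=> mphi x0 phi0 phip id2.
have mphi2 : measurable_fun (`[0%R, +oo[%classic : set R) (fun l => (`|phi l| ^+ 2)%:E).
  apply/measurable_EFinP/measurable_funX/measurableT_comp => //.
  exact: measurable_funS mphi.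
pose c1 := 2 / x ^+ 2; pose c2 := 2 * p ^+ 2 / x ^+ 2.
have c10 : 0 <= c1 by rewrite divr_ge0// sqr_ge0.
have c20 : 0 <= c2 by apply: divr_ge0; [apply: mulr_ge0 => //|]; exact: sqr_ge0.
have mid : measurable_fun (`[0%R, +oo[%classic : set R)
    (fun l => (`|l| ^+ 2)%:E : \bar R).
  apply/measurable_EFinP/measurable_funX.
  by apply: (measurableT_comp (f := @Num.norm R R)) => //; exact: normr_measurable.
have m1 : measurable_fun (`[0%R, +oo[%classic : set R)
    (fun l => c1%:E * (`|l| ^+ 2)%:E)%E.
  exact: measurable_funeM.
apply: (@le_lt_trans _ _
    (\int[nu f]_(l in `[0%R, +oo[) (c1%:E * (`|l| ^+ 2)%:E + c2%:E))%E).
  apply: ge0_le_integral => //.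
  - exact: (emeasurable_funD m1 (measurable_cst (c2%:E : \bar R))).
  - move=> l /=; rewrite in_itv/= andbT => l0.
    rewrite -EFinM -EFinD lee_fin ger0_norm ?phi0// ger0_norm//.
    rewrite /c1 /c2 -mulrAC -mulrDl ler_pdivlMr ?exprn_gt0// -exprMn mulrC.
    apply: (@le_trans _ _ ((l + p) ^+ 2)).
      rewrite lerXn2r ?nnegrE// ?phip//.
        by rewrite mulr_ge0 ?phi0// ltW.
      by rewrite (le_trans _ (phip _ l0))// mulr_ge0 ?phi0// ltW.
    have := sqr_ge0 (l - p); rewrite !expr2; lra.
rewrite ge0_integralD//; first last.
  by move=> l _; rewrite -EFinM lee_fin mulr_ge0// exprn_ge0.
rewrite ge0_integralZl//.
rewrite integral_cst//.
apply: lte_add_pinfty; first by rewrite lte_mul_pinfty// lee_fin.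
rewrite lte_mul_pinfty ?lee_fin//; exact: spectral_measure_fin.
Qed.

End comparison.

(** * Bernstein bijections of the half-line *)

Section bijection.
Context {R : realType}.
Variable g : R -> R.
Hypothesis g_bernstein : bernstein g.
Hypothesis g_bij : set_bij posR posR g.

Lemma posRE (x : R) : posR x = (0 < x) :> Prop.
Proof. by rewrite /posR/= in_itv/= andbT. Qed.

Lemma bernstein_nondecreasing l m : 0 < l -> l <= m -> g l <= g m.
Proof.
case: g_bernstein => _ dg g_ge0 l0; rewrite le_eqVlt => /predU1P[->//|lm].
have pos x : x \in `[l, m] -> 0 < x.
  by rewrite in_itv/= => /andP[lx _]; exact: lt_le_trans lx.
apply: (@ger0_derive1_le_cc _ g l m).
- by move=> x /subset_itv_oo_cc /pos x0; exact: (dg 0%N).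
- move=> x /subset_itv_oo_cc /pos x0.
  by have := g_ge0 1%N x isT x0; rewrite /= expr0 mul1r.
- by apply: derivable_within_continuous => x /pos x0; exact: (dg 0%N).
- by rewrite in_itv/= lexx ltW.
- by rewrite in_itv/= lexx ltW.
- exact: ltW.
Qed.

Lemma bernstein_lt l m : 0 < l -> 0 < m -> (g l < g m) = (l < m).
Proof.
move=> l0 m0; apply/idP/idP => [|lm].
  by apply: contraTT; rewrite -!leNgt; exact: bernstein_nondecreasing.
rewrite lt_neqAle bernstein_nondecreasing// ?ltW// andbT.
apply/eqP => glm; move: lm; case: g_bij => _ g_inj _.
by rewrite (g_inj l m) ?ltxx// inE posRE.
Qed.

Lemma pinv_posK (x : R) : 0 < x -> 0 < pinv posR g x /\ g (pinv posR g x) = x.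
Proof.
move=> x0; case: g_bij => _ _ g_surj; split.
  rewrite -posRE; apply: (surjpinv_image_sub g_surj).
  by exists x => //; rewrite posRE.
by apply: (surjpK _ g_surj); rewrite inE posRE.
Qed.

Lemma pinv_of_bij (x : R) : 0 < x -> pinv posR g (g x) = x.
Proof.
by move=> x0; case: g_bij => _ g_inj _; apply: (pinvKV _ g_inj); rewrite inE posRE.
Qed.

(** A nondecreasing bijection of the half-line tends to 0 at 0. *)
Lemma extend0E : extend0 g = fun l => if 0 < l then g l else 0.
Proof.
apply/funext => l; rewrite /extend0; case: ifP => // _.
apply/cvg_lim => //; apply/cvgrPdist_lt => e e0.
have [x0 gx] := pinv_posK e e0; near=> y.
have y0 : 0 < y by near: y; exact: nbhs_right_gt.
rewrite sub0r normrN gtr0_norm; last by case: g_bernstein => + _ _; exact.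
by rewrite -gx bernstein_lt//; near: y; exact: nbhs_right_lt.
Unshelve. all: by end_near. Qed.

Lemma extend0_ge0 l : 0 <= extend0 g l.
Proof.
rewrite extend0E; case: ifP => // l0.
by case: g_bernstein => + _ _ => /(_ _ l0)/ltW.
Qed.

(** The left endpoint of the ray where [extend0 g] exceeds c. *)
Definition level_knot c : R := if 0 < c then pinv posR g c else 0.

Lemma level_knot_ge0 c : 0 <= c -> 0 <= level_knot c.
Proof. by move=> _; rewrite /level_knot; case: ifP => // /pinv_posK[/ltW]. Qed.

Lemma extend0_level c l : 0 <= c -> (c < extend0 g l) = (level_knot c < l).
Proof.
move=> c0; rewrite extend0E /level_knot; case: ifPn => l0.
  have g0 : 0 < g l by case: g_bernstein => + _ _; exact.
  have [cp|cn] := ltP 0 c; last by rewrite l0 (le_lt_trans cn).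
  by have [y0 gy] := pinv_posK c cp; rewrite -{1}gy bernstein_lt.
rewrite ltNge c0; apply/esym/negbTE; rewrite -leNgt; move: l0; rewrite -leNgt => l0.
by apply: le_trans l0 (level_knot_ge0 c c0).
Qed.

(** For l > 0 this is Psi*(x) >= x y - Psi(y) at y = g(l). *)
Lemma extend0_legendre (x p : R) : 0 < x -> 0 <= p ->
  legendre (pinv posR g) x = p%:E ->
  forall l, 0 <= l -> x * extend0 g l <= l + p.
Proof.
move=> x0 p0 xp l; rewrite extend0E le_eqVlt => /predU1P[<-|l0].
  by rewrite ltxx mulr0 add0r.
rewrite l0 -lerBlDl -lee_fin -xp; apply: ereal_sup_ubound.
exists (g l); last by rewrite pinv_of_bij.
by rewrite posRE; case: g_bernstein => + _ _; exact.
Qed.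

End bijection.

(** * The super-Poincare inequality of A *)

(** With I = (f, f), H = (A f, f), H' = (g(A) f, f) and r = e t x: bounding H'
    in the inequality of g(A) produces (1 - e) I, which goes to the left. *)
Lemma absorb {R : realFieldType} (e t x p I H H' G N : R) :
  0 < e -> 0 <= e * t -> e * t * p = 1 - e ->
  x * H' <= H + p * I -> I <= e * t * x * H' + G * N ->
  I <= t * H + e^-1 * G * N.
Proof.
move=> e0 et0 etp /(ler_wpM2l et0) le1 le2; rewrite -(ler_pM2l e0).
have -> : e * (t * H + e^-1 * G * N) = e * t * H + G * N by field; rewrite gt_eqF.
have pI : e * t * (p * I) = (1 - e) * I by rewrite mulrA etp.
by move: le1; rewrite mulrDr pI; lra.
Qed.

Theorem corollary5p3 (d : measure_display) (T : measurableType d)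
  (R : realType) (mu : {sigma_finite_measure set T -> \bar R})
  (g : R -> R) (A : operator mu) (E : spectral_resolution mu)
  (gamma : R -> R) :
  bernstein g ->
  set_bij posR posR g ->
  densely_defined A -> symmetric_op A -> nonnegative_op A ->
  spectral_resolution_of (friedrichs A) E ->
  let Psi := pinv posR g in
  set_bij posR (EFin @` posR) (legendre Psi) ->
  (forall r, 0 < r -> 0 < gamma r) ->
  super_poincare (spectral_integral E (extend0 g)) gamma ->
  super_poincare (friedrichs A) (rate gamma Psi).
Proof.
move=> bg gbij _ _ _ AE Psi Lbij _ spg f h Afh f1 t t0.
have [id2 hE] := (AE f h).1 Afh.
have Lpos p : 0 < p -> 0 < pinv posR (legendre Psi) p%:E /\
    legendre Psi (pinv posR (legendre Psi) p%:E) = p%:E.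
  move=> p0; case: Lbij => _ _ L_surj.
  have Ep : (EFin @` posR) p%:E by exists p => //; rewrite posRE.
  split; last by apply: (surjpK _ L_surj); rewrite inE.
  by rewrite -posRE; apply: (surjpinv_image_sub L_surj); exists p%:E.
have mG : measurable_fun setT (extend0 g).
  apply: (measurable_level _ (level_knot g)); first exact: extend0_ge0.
  by move=> c l; exact: extend0_level.
have G_nd : {homo extend0 g : l m / l <= m}.
  apply: (level_nondecreasing _ (level_knot g)); first exact: extend0_ge0.
  by move=> c l; exact: extend0_level.
have G2 : (\int[spectral_measure E f]_(l in `[0%R, +oo[)
    (`|extend0 g l| ^+ 2)%:E < +oo)%E.
  have [x0 xE] := Lpos 1 ltr01.
  apply: (sqr_integral_affine_growth _ _ 1 _ mG x0) id2.
  - by move=> l _; exact: extend0_ge0.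
  - exact: extend0_legendre xE.
(* h' represents g(A) f *)
have [h' h'E] := spectral_integral_ex E (extend0 g) (level_knot g)
  (extend0_ge0 g bg gbij) (level_knot_ge0 g gbij) (extend0_level g bg gbij) f G2.
have Gf : spectral_integral E (extend0 g) f h'.
  split => // u; under eq_cvg do rewrite h'E; exact: inner_proj_cvg.
have gA_le x p : 0 < x -> 0 <= p -> legendre Psi x = p%:E ->
    x * inner h' f <= inner h f + p * inner f f.
  move=> x0 p0 xp.
  have cG : x * spectral_pairing E (extend0 g) n f f @[n --> \oo] --> x * inner h' f.
    by apply: cvgMl_tmp; exact: Gf.2.
  have cid : spectral_pairing E idfun n f f + p * inner f f @[n --> \oo] -->
      inner h f + p * inner f f.
    by apply: cvgD; [exact: hE|exact: cvg_cst].
  apply: (ler_cvg_to cG cid); apply: nearW => n.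
  apply: spectral_pairing_le => //.
  exact: (extend0_legendre g bg gbij x p x0 p0 xp).
pose N := Lpnorm mu 1 f ^+ 2.
have key e : 0 < e < 1 -> inner f f <= t * inner h f +
    e^-1 * gamma (e * t * pinv posR (legendre Psi) ((1 - e) / (e * t))%:E) * N.
  move=> /andP[e0 e1]; have et0 : 0 < e * t by exact: mulr_gt0.
  set p := (1 - e) / (e * t).
  have p0 : 0 < p by rewrite divr_gt0// subr_gt0.
  have [x0 xp] := Lpos p p0; set x := pinv _ _ _ in x0 xp *.
  have := spg f h' Gf f1 (e * t * x) (mulr_gt0 et0 x0).
  rewrite -innerff -/N => sp.
  have etp : e * t * p = 1 - e by rewrite /p mulrC divfK// gt_eqF.
  exact: absorb e0 (ltW et0) etp (gA_le x p x0 (ltW p0) xp) sp.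
rewrite -innerff -lerBlDl.
(* the infimum can be compared with after dividing by N; if N = 0, any value
   of e will do *)
have [N0|Nn0] := eqVneq N 0.
  have := key 2^-1; rewrite -/N N0 !mulr0 addr0 => k.
  by rewrite subr_le0; apply: k; apply/andP; split; lra.
have Np : 0 < N by rewrite lt_def Nn0 sqr_ge0.
rewrite -ler_pdivrMr//; apply: lb_le_inf.
  by eexists; exists 2^-1; [rewrite /= in_itv/=; apply/andP; split; lra|].
move=> _ [e /= e01 <-]; rewrite ler_pdivrMr// lerBlDl; apply: key.
by move: e01; rewrite in_itv.
Qed.
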